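(* Let $M,N\ge1$ be integers, $P,\sigma^2,\beta_1,\beta_2>0$, $\varphi_1\in\mathbb{R}$, let $\mathbf{a}_{2,1}\in\mathbb{C}^M$ have unit-modulus entries, let $\mathbf{h}_3\in\mathbb{C}^M$, and put $x=\mathbf{h}_3^{H}\mathbf{a}_{2,1}e^{\mathsf{j}\varphi_1}$. For $\alpha\ge0$ define $$\mathrm{SNR}_{\rm NCR}(\alpha)=\frac{P\alpha^2M\beta_1\beta_2-P\alpha^2\beta_2|x|^2+2P\alpha\sqrt{\beta_1\beta_2}\,\Re(x)}{\sigma^2(1+\alpha^2\beta_2M)}+\frac{P\|\mathbf{h}_3\|^2}{\sigma^2},$$ $$\mathrm{SNR}_{\rm P\text{-}RIS}=\frac{P\left(\|\mathbf{h}_3\|^2+\beta_1\beta_2N^2M+2\sqrt{\beta_1\beta_2}\,N|x|\right)}{\sigma^2}.$$ Let $g=\beta_1\beta_2N^2M+2\sqrt{\beta_1\beta_2}\,N|x|$ and $$\mathcal{A}=M\beta_1\beta_2-|x|^2\beta_2-\beta_2Mg,\qquad \mathcal{B}=2\Re(x)\sqrt{\beta_1\beta_2},\qquad \mathcal{C}=-g.$$ Say that the repeater with gain $\alpha\ge0$ outperforms the passive RIS if $\mathrm{SNR}_{\rm NCR}(\alpha)\ge\mathrm{SNR}_{\rm P\text{-}RIS}$. This holds if and only if $\mathcal{A}\alpha^2+\mathcal{B}\alpha+\mathcal{C}\ge0$. Moreover: (1) If $\mathcal{A}>0$ and $\alpha>\frac{-\mathcal{B}+\sqrt{\mathcal{B}^2-4\mathcal{A}\mathcal{C}}}{2\mathcal{A}}$,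 the repeater outperforms the passive RIS. (2) Suppose $\mathcal{A}=0$. If $\Re(x)\le0$, the repeater does not outperform the passive RIS for any $\alpha\ge0$. If $\Re(x)>0$ and $\alpha>-\mathcal{C}/\mathcal{B}$, the repeater outperforms the passive RIS. (3) Suppose $\mathcal{A}<0$. If $\Re(x)\le0$, the repeater does not outperform the passive RIS for any $\alpha\ge0$. If $\Re(x)>0$ and $\mathcal{B}^2-4\mathcal{A}\mathcal{C}\ge0$, the repeater outperforms the passive RIS whenever $$\alpha\in\left(\frac{-\mathcal{B}+\sqrt{\mathcal{B}^2-4\mathcal{A}\mathcal{C}}}{2\mathcal{A}},\ \frac{-\mathcal{B}-\sqrt{\mathcal{B}^2-4\mathcal{A}\mathcal{C}}}{2\mathcal{A}}\right).$$
   Context: $\mathsf{j}$ is the imaginary unit, $(\cdot)^H$ is the conjugate transpose, $\Re$ is the real part, and $\|\cdot\|$ is the Euclidean norm. The two SNRs are the maximal uplink signal-to-noise ratios, in the presence of a direct user–base-station channel $\mathbf{h}_3$, with a network-controlled repeater (NCR) of gain $\alpha$ and with an optimally configured passive RIS with $N$ elements, respectively. *)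

(* Defs.v *)
From mathcomp Require Export all_boot all_order all_algebra.
From mathcomp Require Export reals trigo.
From mathcomp.real_closed Require Export complex.

Set Implicit Arguments.
Unset Strict Implicit.
Unset Printing Implicit Defensive.

Export Order.TTheory GRing.Theory Num.Theory.
Export ComplexField.Normc.

Local Open Scope ring_scope.
Local Open Scope complex_scope.
Local Open Scope sesquilinear_scope.

Section Snr.
Variable R : realType.

Definition expj (t : R) : R[i] := cos t +i* sin t.

(* The library norm on matrices is the sup norm, hence this definition;
   [normc] is the modulus with values in [R] rather than [R[i]]. *)
Definition vnorm n (h : 'cV[R[i]]_n) : R :=
  Num.sqrt (\sum_(i < n) normc (h i ord0) ^+ 2).

Definition xval M (h3 a21 : 'cV[R[i]]_M) (phi1 : R) : R[i] :=
  (h3 ^t* *m a21) ord0 ord0 * expj phi1.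

(* The SNRs take [x] as a separate argument, to be instantiated with [xval]. *)
Variables (M N : nat) (P sigma2 beta1 beta2 : R).
Variables (h3 : 'cV[R[i]]_M) (x : R[i]).

Definition snr_ncr (alpha : R) : R :=
  (P * alpha ^+ 2 * M%:R * beta1 * beta2
     - P * alpha ^+ 2 * beta2 * normc x ^+ 2
     + 2 * P * alpha * Num.sqrt (beta1 * beta2) * complex.Re x)
    / (sigma2 * (1 + alpha ^+ 2 * beta2 * M%:R))
  + P * vnorm h3 ^+ 2 / sigma2.

Definition snr_ris : R :=
  P * (vnorm h3 ^+ 2 + beta1 * beta2 * N%:R ^+ 2 * M%:R
       + 2 * Num.sqrt (beta1 * beta2) * N%:R * normc x) / sigma2.

Definition ncr_outperforms_ris (alpha : R) : Prop :=
  snr_ris <= snr_ncr alpha.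

End Snr.

(* Main.v *)
Require Import Defs.
From mathcomp Require Import ring lra.

Set Implicit Arguments.
Unset Strict Implicit.
Unset Printing Implicit Defensive.

Local Open Scope ring_scope.
Local Open Scope complex_scope.

(** The difference of the two SNRs is a positive factor times the quadratic
    [A * alpha ^+ 2 + B * alpha + C] ([snr_ncr_sub_ris]), so everything reduces to the sign of that
    quadratic on [0 <= alpha]. Its constant term is negative and [B] has the sign of the real part
    of [x]. Hence it stays negative when [A] and [B] are both nonpositive; the remaining claims are
    the linear case and two facts on real quadratics, both read off from the completed square
    [quadratic_disc]. *)

Lemma normc_ge0 (R : rcfType) (z : R[i]) : 0 <= normc z.
Proof. by case: z => a b; rewrite sqrtr_ge0. Qed.

Lemma quadratic_disc (R : comPzRingType) (a b c t : R) :
  4 * a * (a * t ^+ 2 + b * t + c)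
  = (2 * a * t + b) ^+ 2 - (b ^+ 2 - 4 * a * c).
Proof. by ring. Qed.

(* Also valid for a negative discriminant, whose [Num.sqrt] is 0. *)
Lemma quadratic_ge0_above_root (R : rcfType) (a b c t : R) :
  0 < a -> (- b + Num.sqrt (b ^+ 2 - 4 * a * c)) / (2 * a) < t ->
  0 <= a * t ^+ 2 + b * t + c.
Proof.
move=> a_gt0; have a2_gt0 : 0 < 2 * a by lra.
rewrite ltr_pdivrMr // => t_gt.
have a4_gt0 : 0 < 4 * a by lra.
rewrite -(pmulr_rge0 _ a4_gt0) quadratic_disc subr_ge0.
set d := b ^+ 2 - _ in t_gt *.
have s_ge0 := sqrtr_ge0 d.
have s_le : Num.sqrt d <= 2 * a * t + b by lra.
(* A negative [d] lies below any square; otherwise the nonnegative bound [s_le] can be squared. *)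
have [d_ge0|/ltW d_le0] := leP 0 d; last exact: le_trans d_le0 (sqr_ge0 _).
by rewrite -(sqr_sqrtr d_ge0) lerXn2r // nnegrE; lra.
Qed.

Lemma quadratic_ge0_between_roots (R : rcfType) (a b c t : R) :
  a < 0 -> 0 <= b ^+ 2 - 4 * a * c ->
  (- b + Num.sqrt (b ^+ 2 - 4 * a * c)) / (2 * a) < t
    < (- b - Num.sqrt (b ^+ 2 - 4 * a * c)) / (2 * a) ->
  0 <= a * t ^+ 2 + b * t + c.
Proof.
move=> a_lt0 d_ge0; have a2_lt0 : 2 * a < 0 by lra.
(* Clearing the negative denominator flips both bounds: [2 * a * t + b] lies strictly between the
   two square roots of the discriminant, so both factors of the final difference of squares are
   positive. *)
rewrite ltr_ndivrMr // ltr_ndivlMr // => /andP[t_gt t_lt].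
have a4_lt0 : 4 * a < 0 by lra.
rewrite -(nmulr_rle0 _ a4_lt0) quadratic_disc subr_le0 -[leRHS]sqr_sqrtr //.
by rewrite -subr_ge0 subr_sqr mulr_ge0; lra.
Qed.

(** The terms in [vnorm h3] cancel. Over the common denominator, [g] gets multiplied by
    [1 + alpha ^+ 2 * beta2 * M%:R], which puts [- beta2 * M%:R * g] in the leading coefficient and
    [- g] in the constant one. *)
Lemma snr_ncr_sub_ris (R : realType) (M N : nat)
    (P sigma2 beta1 beta2 alpha : R) (h3 : 'cV[R[i]]_M) (x : R[i]) :
  let g := beta1 * beta2 * N%:R ^+ 2 * M%:R
           + 2 * Num.sqrt (beta1 * beta2) * N%:R * normc x in
  sigma2 != 0 -> 1 + alpha ^+ 2 * beta2 * M%:R != 0 ->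
  snr_ncr P sigma2 beta1 beta2 h3 x alpha - snr_ris N P sigma2 beta1 beta2 h3 x
  = P / (sigma2 * (1 + alpha ^+ 2 * beta2 * M%:R))
    * ((M%:R * beta1 * beta2 - normc x ^+ 2 * beta2 - beta2 * M%:R * g)
         * alpha ^+ 2
       + 2 * complex.Re x * Num.sqrt (beta1 * beta2) * alpha - g).
Proof. by rewrite /= /snr_ncr /snr_ris => ? ?; field; apply/andP. Qed.

Theorem mainTheorem12 (R : realType) (M N : nat)
    (P sigma2 beta1 beta2 phi1 : R) (a21 h3 : 'cV[R[i]]_M)
    (M_ge1 : (1 <= M)%N) (N_ge1 : (1 <= N)%N)
    (P_gt0 : 0 < P) (sigma2_gt0 : 0 < sigma2)
    (beta1_gt0 : 0 < beta1) (beta2_gt0 : 0 < beta2)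
    (a21_unit : forall i, normc (a21 i ord0) = 1) :
  let x : R[i] := xval h3 a21 phi1 in
  let g : R := beta1 * beta2 * N%:R ^+ 2 * M%:R
               + 2 * Num.sqrt (beta1 * beta2) * N%:R * normc x in
  let A : R := M%:R * beta1 * beta2 - normc x ^+ 2 * beta2
               - beta2 * M%:R * g in
  let B : R := 2 * complex.Re x * Num.sqrt (beta1 * beta2) in
  let C : R := - g in
  let disc : R := B ^+ 2 - 4 * A * C in
  let outperforms : R -> Prop :=
    ncr_outperforms_ris N P sigma2 beta1 beta2 h3 x in
  (forall alpha : R, 0 <= alpha ->
     (outperforms alpha <-> 0 <= A * alpha ^+ 2 + B * alpha + C)) /\
  (0 < A -> forall alpha : R, 0 <= alpha ->
     (- B + Num.sqrt disc) / (2 * A) < alpha -> outperforms alpha) /\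
  (A = 0 ->
     (complex.Re x <= 0 -> forall alpha : R, 0 <= alpha -> ~ outperforms alpha) /\
     (0 < complex.Re x -> forall alpha : R, 0 <= alpha ->
        - C / B < alpha -> outperforms alpha)) /\
  (A < 0 ->
     (complex.Re x <= 0 -> forall alpha : R, 0 <= alpha -> ~ outperforms alpha) /\
     (0 < complex.Re x -> 0 <= disc -> forall alpha : R, 0 <= alpha ->
        (- B + Num.sqrt disc) / (2 * A) < alpha
          < (- B - Num.sqrt disc) / (2 * A) -> outperforms alpha)).
Proof.
move=> x g A B C disc outperforms.
have M_gt0 : 0 < M%:R :> R by rewrite ltr0n.
have N_gt0 : 0 < N%:R :> R by rewrite ltr0n.
have s_gt0 : 0 < Num.sqrt (beta1 * beta2) by rewrite sqrtr_gt0 mulr_gt0.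
(* Strictness comes from the first summand of [g], as [M] and [N] are positive; the second vanishes
   when [x] is 0. *)
have C_lt0 : C < 0.
  rewrite oppr_lt0 ltr_pwDl ?mulr_gt0 ?exprn_gt0 //.
  by rewrite !mulr_ge0 ?normc_ge0 // ltW.
have quadE alpha : 0 <= alpha ->
    (outperforms alpha <-> 0 <= A * alpha ^+ 2 + B * alpha + C).
  move=> alpha_ge0; have D_gt0 : 0 < 1 + alpha ^+ 2 * beta2 * M%:R.
    by rewrite ltr_pwDl // !mulr_ge0 // ltW.
  rewrite /outperforms /ncr_outperforms_ris -subr_ge0 snr_ncr_sub_ris ?gt_eqF //.
  by rewrite pmulr_rge0 // divr_gt0 ?mulr_gt0.
(* Serves both [A = 0] and [A < 0]: the quadratic is then at most [C]. *)
have never : A <= 0 -> complex.Re x <= 0 ->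
    forall alpha, 0 <= alpha -> ~ outperforms alpha.
  move=> A_le0 x_le0 alpha alpha_ge0 /(quadE _ alpha_ge0); apply/negP.
  have B_le0 : B <= 0 by rewrite mulr_le0_ge0 ?pmulr_rle0 // ltW.
  have := mulr_le0_ge0 A_le0 (sqr_ge0 alpha).
  by have := mulr_le0_ge0 B_le0 alpha_ge0; rewrite -ltNge; lra.
split; first exact: quadE.
split=> [A_gt0 alpha alpha_ge0 alpha_gt|].
  by apply/quadE => //; apply: quadratic_ge0_above_root.
split=> [A0|A_lt0].
  split=> [|x_gt0]; first by apply: never; rewrite A0.
  move=> alpha alpha_ge0; have B_gt0 : 0 < B by rewrite !mulr_gt0.
  by rewrite ltr_pdivrMr // => alpha_gt; apply/quadE => //; rewrite A0; lra.
split=> [|x_gt0 disc_ge0]; first by apply: never; rewrite ltW.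
move=> alpha alpha_ge0 alpha_in; apply/quadE => //.
exact: quadratic_ge0_between_roots.
Qed.
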